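(* Assume that $F^\epsilon$ admits a density $f^\epsilon$ and that $|\mathcal{B}_0|=1$ (so $\mathcal{B}_0=\{\beta_0\}$). In addition assume that $\mathbb{P}(\alpha^TX=0)=0$ for any $\alpha\in\mathbb{R}^d$ with $\alpha\ne 0$. Then for all $\hat\beta_n\in\mathcal{B}_{n,2}$, $$\hat\beta_n\stackrel{\mathbb{P}}{\longrightarrow}\beta_0\quad\text{as }n\to\infty.$$
   Context: Let $d\ge 1$, let $X$ be a random vector in $\mathbb{R}^d$ with a continuous distribution, $\epsilon$ a real random variable (noise) with known cumulative distribution function $F^\epsilon$, independent of $X$, $\beta_0\in\mathbb{R}^d$ deterministic, and $Y$ a real random variable with $Y\stackrel{d}{=}\beta_0^TX+\epsilon$, i.e. $F^Y=F^{\beta_0^TX}\star F^\epsilon$, where $F^Z$ denotes the cumulative distribution function of $Z$ and $[F^{\beta^TX}\star F^\epsilon](y)=\int F^\epsilon(y-\beta^Tx)\,dF^X(x)$. One observes two independent samples: $Y_1,\dots,Y_n$ i.i.d. distributed as $Y$, and $X_1,\dots,X_n$ i.i.d. distributed as $X$. Let $F^Y_n(y)=n^{-1}\sum_{i=1}^n\mathbf{1}\{Y_i\le y\}$ and $$\mathbb{D}_{n,2}(\beta)=\int\Big(F^Y_n(y)-n^{-1}\sum_{i=1}^nF^\epsilon(y-\beta^TX_i)\Big)^2dF^Y_n(y).$$ $\mathcal{B}_{n,2}$ is the set of all minimizers of $\mathbb{D}_{n,2}$ over $\mathbb{R}^d$. $\mathcal{B}_0=\{\beta\in\mathbb{R}^d: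 F^Y=F^{\beta^TX}\star F^\epsilon\}$ is the set of all regression vectors for which the model holds. *)

(* Defs.v *)
From HB Require Import structures.
From mathcomp Require Import all_boot all_order all_algebra finmap.
From mathcomp Require Import all_classical all_reals all_analysis.

Set Implicit Arguments.
Unset Strict Implicit.
Unset Printing Implicit Defensive.

Import Order.TTheory GRing.Theory Num.Theory.
Import numFieldNormedType.Exports.

Local Open Scope classical_set_scope.
Local Open Scope ring_scope.

(* R^d with its Borel sigma-algebra; convertible to 'rV[R]_d, whose library
   topology is the usual one. *)
Definition borel_rV (R : realType) (d : nat) := g_sigma_algebraType (@open 'rV[R]_d).

Definition dotv (R : realType) (d : nat) (b x : 'rV[R]_d) : R :=
  \sum_(j < d) b 0 j * x 0 j.

Section independence.
Context d (T : measurableType d) (R : realType) (P : probability T R).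
Local Open Scope ereal_scope.

Definition independent_systems (F G : set (set T)) : Prop :=
  forall A B, F A -> G B -> P (A `&` B) = P A * P B.

(* [finset] below is finmap's: J ranges over the finite sets of indices. *)
Definition mutually_independent_systems (F : nat -> set (set T)) : Prop :=
  forall (J : {fset nat}) (E : nat -> set T),
    (forall i, i \in J -> F i (E i)) ->
    P (\bigcap_(i in [set` J]) E i) = \prod_(i <- J) P (E i).

End independence.

Section random_elements.
Context d d' (T : measurableType d) (T' : measurableType d') (R : realType)
  (P : probability T R).

Definition sigma_of (X : T -> T') : set (set T) :=
  preimage_set_system setT X measurable.

Definition sigma_of_seq (X : nat -> T -> T') : set (set T) :=
  <<s \bigcup_i sigma_of (X i) >>.

(* Restricted to measurable sets: the value of a measure elsewhere carries no
   information. *)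
Definition same_distribution (X Y : T -> T') : Prop :=
  forall A, measurable A -> pushforward P X A = pushforward P Y A.

Definition iid_copies (Z : T -> T') (Zs : nat -> T -> T') : Prop :=
  mutually_independent_systems P (fun i => sigma_of (Zs i)) /\
  forall i, same_distribution (Zs i) Z.

End random_elements.

(* "Continuous distribution" is taken in the weakest sense, absence of atoms. *)
Definition continuous_distribution d (T : measurableType d) (R : realType)
    (P : probability T R) (k : nat) (X : {RV P >-> borel_rV R k}) : Prop :=
  forall x : 'rV[R]_k, distribution P X [set x] = 0%E.

Definition has_density d (T : measurableType d) (R : realType)
    (P : probability T R) (Z : {RV P >-> R}) : Prop :=
  exists f : R -> R,
    [/\ measurable_fun setT f, forall x, 0 <= f x &
        forall y, cdf Z y = (\int[lebesgue_measure]_(x in `]-oo, y]) (f x)%:E)%E].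

(* The real-valued version of the library's extended-real-valued [cdf]. *)
Definition cdfR d (T : measurableType d) (R : realType) (P : probability T R)
  (Z : {RV P >-> R}) (y : R) : R := fine (cdf Z y).

Section unmatched_regression.
Context d (T : measurableType d) (R : realType) (P : probability T R) (k : nat).

(* [F^(b.X) * F](y), the integral of F(y - b.x) against the law of X *)
Definition convolved_cdf (X : {RV P >-> borel_rV R k}) (F : R -> R)
    (b : 'rV[R]_k) (y : R) : \bar R :=
  (\int[distribution P X]_x (F (y - dotv b x))%:E)%E.

Definition regression_vectors (X : {RV P >-> borel_rV R k})
    (eps Y : {RV P >-> R}) : set 'rV[R]_k :=
  [set b | forall y, cdf Y y = convolved_cdf X (cdfR eps) b y].

End unmatched_regression.

Section criterion.
Context (R : realType) (k : nat) (n : nat).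
Variables (F : R -> R) (xs : nat -> 'rV[R]_k) (ys : nat -> R).

Definition empirical_cdf (y : R) : R := n%:R^-1 * \sum_(i < n) (ys i <= y)%R%:R.

(* the measure with distribution function [empirical_cdf] when n > 0 *)
Definition empirical_measure : set R -> \bar R :=
  mscale (n%:R^-1)%:nng (msum (fun i => \d_(ys i)) n).

HB.instance Definition _ := Measure.on empirical_measure.

Definition criterion (b : 'rV[R]_k) : \bar R :=
  (\int[empirical_measure]_y
    ((empirical_cdf y - n%:R^-1 * \sum_(i < n) F (y - dotv b (xs i))) ^+ 2)%:E)%E.

(* Can be empty: with n = 1 and F < 1 everywhere, the infimum of the criterion
   may be approached only as b goes to infinity. *)
Definition minimizers : set 'rV[R]_k :=
  [set b | forall b', (criterion b <= criterion b')%E].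

End criterion.

(* [`|_|] is the sup norm of 'rV[R]_k; all norms on R^k define the same notion. *)
Definition cvg_in_probability d (T : measurableType d) (R : realType)
    (P : probability T R) (k : nat) (Z : nat -> T -> 'rV[R]_k) (z : 'rV[R]_k)
    : Prop :=
  forall e : R, 0 < e -> P [set w | e <= `|Z n w - z|] @[n --> \oo] --> 0%E.

(* Main.v *)
(* Only the values of [F_n^Y] and of
   [G_n(b, y) = n^-1 \sum_i F^eps (y - b.X_i)] matter. Both are nondecreasing
   in [y], so the weak law of large numbers at finitely many points makes
   [F_n^Y] and [G_n(beta0, .)] uniformly close to the continuous function [F^Y]
   with high probability, and the criterion at [beta0] tends to 0. Conversely a
   single point [y] with [|F^Y y - G_n(b, y)| >= 8 e] forces the criterion at [b]
   to be at least [18 e^3]: by monotonicity the gap extends to an interval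
   carrying empirical mass.

   Such a point exists, uniformly over the [b] with [|b - beta0| >= e]. On a
   compact set this follows from identifiability and from the weak law for
   brackets of [b' |-> F^eps (y - b'.X)] near each [b]. For large [b], no
   hyperplane through the origin carries mass, so by compactness of the sphere
   few of the [b.X_i] lie in a bounded interval; then [G_n(b, .)] is almost
   constant between two quantiles of [F^Y]. In particular, with high probability
   the criterion has a minimizer, which is within [e] of [beta0]. *)
Require Import Defs.
From HB Require Import structures.
From mathcomp Require Import all_boot all_order all_algebra finmap.
From mathcomp Require Import ring lra.
From mathcomp Require Import all_classical all_reals all_analysis measurable_realfun.

Set Implicit Arguments.
Unset Strict Implicit.
Unset Printing Implicit Defensive.

Import Order.TTheory GRing.Theory Num.Theory.
Import numFieldNormedType.Exports.

Local Open Scope classical_set_scope.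
Local Open Scope ring_scope.

(** * Events whose probability tends to one *)

Section with_high_probability.
Context d (T : measurableType d) (R : realType) (P : probability T R).

(* As a filter, [whp] can be used in [near_covering], which turns locally uniform
   convergence in probability into uniform convergence on compact sets. *)
Definition whp : set_system (nat * T) :=
  [set Q | exists A : nat -> set T, [/\ forall n, measurable (A n),
     P (A n) @[n --> \oo] --> 0%E & forall n w, ~ A n w -> Q (n, w)]].

#[export] Instance whp_filter : Filter whp.
Proof.
split.
- by exists (fun=> set0); split => // ; rewrite measure0; exact: cvg_cst.
- move=> Q1 Q2 [A1 [mA1 PA1 A1Q]] [A2 [mA2 PA2 A2Q]].
  exists (fun n => A1 n `|` A2 n); split.
  + by move=> n; exact: measurableU.
  + apply: (@squeeze_cvge _ _ _ _ (cst 0%E) _ (fun n => P (A1 n) + P (A2 n))%E).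
    * by apply: nearW => n; rewrite measure_ge0 measureU2.
    * exact: cvg_cst.
    * by rewrite -[X in _ --> X]adde0; apply: cvgeD.
  + by move=> n w /not_orP[nA1 nA2]; split; [exact: A1Q|exact: A2Q].
- move=> Q1 Q2 Q12 [A [mA PA AQ]]; exists A; split => // n w nA.
  exact/Q12/AQ.
Qed.

Lemma whp_eventually (E : set nat) : (\forall n \near \oo, E n) ->
  whp [set nw | E nw.1].
Proof.
move=> EN; exists (fun n => [set _ | ~ E n]); split => /=.
- by move=> n; case: (pselect (E n)) => h;
    [rewrite (_ : mkset _ = set0)|rewrite (_ : mkset _ = setT)] => //;
    apply/seteqP; split.
- apply: cvg_near_cst; near=> n.
  by rewrite (_ : mkset _ = set0) ?measure0//; apply/seteqP; split => // w /=;
    apply; near: n.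
- by move=> n _; apply: contrapT.
Unshelve. all: by end_near. Qed.

Lemma whp_cvg0 (A : nat -> set T) : (forall n, measurable (A n)) ->
  whp [set nw | ~ A nw.1 nw.2] -> P (A n) @[n --> \oo] --> 0%E.
Proof.
move=> mA [B [mB PB BA]].
apply: (@squeeze_cvge _ _ _ _ (cst 0%E) _ (fun n => P (B n))) => //.
- apply: nearW => n; rewrite measure_ge0/= le_measure ?inE// => w Aw.
  by apply: contrapT => /BA.
- exact: cvg_cst.
Qed.

End with_high_probability.

(** * The weak law of large numbers for events *)

Section weak_law.
Context d (T : measurableType d) (R : realType) (P : probability T R).

Definition avg (n : nat) (u : nat -> R) : R := n%:R^-1 * \sum_(i < n) u i.

Lemma Lfun_indic (A : set T) (p : R) : measurable A -> 1 <= p ->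
  \1_A \in Lfun P p%:E.
Proof.
move=> mA p1; have p0 : p != 0 by rewrite gt_eqF// (lt_le_trans ltr01).
rewrite inE; apply/andP; split; rewrite inE/=; first exact: measurable_indic.
rewrite /finite_norm unlock /Lnorm poweR_lty//=.
under eq_integral => w _.
  rewrite (_ : `|_| `^ p = \1_A w); last first.
    rewrite /= indicE; case: (w \in A); rewrite ?normr1 ?powR1// normr0.
    by rewrite powR0.
  over.
rewrite integral_indic// setIT; apply: le_lt_trans (ltry 1).
exact: probability_le1.
Qed.

Section events.
Variables (A : nat -> set T) (p : R).
Hypothesis mA : forall i, measurable (A i).
Hypothesis PA : forall i, P (A i) = p%:E.
Hypothesis A_indep : forall i j, i != j -> P (A i `&` A j) = (p ^+ 2)%:E.

Let S n : T -> R := \sum_(i < n) \1_(A i).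

Let S_Lfun n : S n \in Lfun P 2%:E.
Proof.
rewrite /S; apply: rpred_sum => [|? i _]; rewrite ?lee1n//.
by apply: Lfun_indic; rewrite // ler1n.
Qed.

Let A_Lfun i : \1_(A i) \in Lfun P 2%:E.
Proof. by apply: Lfun_indic; rewrite // ler1n. Qed.

Let Lfun21 (f : T -> R) : f \in Lfun P 2%:E -> f \in Lfun P 1.
Proof. exact/Lfun_subset12/fin_num_measure. Qed.

Let cov_A i j : i != j -> covariance P (\1_(A i)) (\1_(A j)) = 0%E.
Proof.
move=> ij; rewrite covarianceE; last 3 first.
- exact/Lfun21.
- exact/Lfun21.
- exact: Lfun2_mul_Lfun1.
rewrite (_ : \1_(A i) * \1_(A j) = \1_(A i `&` A j)); last first.
  by rewrite indicI; apply/funext.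
rewrite !expectation_indic//; last exact: measurableI.
by rewrite A_indep// !PA -EFinM -EFinB expr2 subrr.
Qed.

Let cov_S n j : (n <= j)%N -> covariance P (S n) (\1_(A j)) = 0%E.
Proof.
elim: n => [|n ih] nj; first by rewrite /S big_ord0 covariance_cst_l.
rewrite /S big_ord_recr/= covarianceDl//; last exact: S_Lfun.
by rewrite ih ?(ltnW nj)// add0e cov_A// ltn_eqF.
Qed.

Let var_A i : (variance P (\1_(A i)) <= 1)%E.
Proof.
rewrite varianceE//.
rewrite (_ : \1_(A i) ^+ 2 = \1_(A i)); last first.
  by rewrite -[in RHS](setIid (A i)) indicI; apply/funext.
rewrite expectation_indic// PA -EFin_expe -EFinB lee_fin.
have : (p%:E <= 1%E)%E by rewrite -(PA i) probability_le1.
rewrite lee_fin => p1; rewrite (le_trans _ p1)// gerBl sqr_ge0//.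
Qed.

Let var_S n : (variance P (S n) <= n%:R%:E)%E.
Proof.
elim: n => [|n ih]; first by rewrite /S big_ord0 variance_cst.
rewrite /S big_ord_recr/= varianceD//; last exact: S_Lfun.
rewrite cov_S// mule0 adde0 -natr1 EFinD leeD//.
Qed.

Let exp_S n : ('E_P[S n] = (n%:R * p)%:E)%E.
Proof.
elim: n => [|n ih]; first by rewrite /S big_ord0 expectation_cst mul0r.
rewrite /S big_ord_recr/= expectationD; [|exact/Lfun21/S_Lfun|exact/Lfun21].
by rewrite ih expectation_indic// PA -EFinD -natr1 mulrDl mul1r.
Qed.

(** Chebyshev's inequality: pairwise independence makes the covariances vanish, so the count [S n]
    has variance at most [n], and it deviates from its mean by [n * e] with probability at most
    [1 / (n * e ^ 2)]. *)
Lemma weak_law_events (e : R) : 0 < e ->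
  \forall nw \near whp P, `|avg nw.1 (fun i => \1_(A i) nw.2) - p| < e.
Proof.
move=> e0.
have mS n : measurable_fun setT (S n) by exact: (set_mem (sub_Lfun_mfun (S_Lfun n))).
pose SR n : {RV P >-> R} := HB.pack (S n) (isMeasurableFun.Build _ _ _ _ _ (mS n)).
pose B n := [set w | n%:R * e <= `|S n w - n%:R * p|].
have mB n : measurable (B n).
  rewrite -[B n]setTI; apply: measurable_fun_le => //.
  by apply: measurableT_comp => //; exact: measurable_funB.
(* For [n = 0] the average is 0 by convention, so only positive [n] can satisfy the bound. *)
have : whp P [set nw | 0 < nw.1]%N.
  by apply: (@whp_eventually _ _ _ P (fun n => 0 < n)%N); exists 1%N.
move=> n_gt0; have whpB : whp P [set nw | ~ B nw.1 nw.2].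
  exists B; split => //.
  have h (n : nat) : (0 < n)%N -> (P (B n) <= (n%:R^-1 * (e ^- 2))%:E)%E.
    move=> n0; have nR0 : 0 < n%:R :> R by rewrite ltr0n.
    have := chebyshev (SR n) (mulr_gt0 nR0 e0); rewrite exp_S/= => /le_trans; apply.
    apply: (@le_trans _ _ (((n%:R * e) ^- 2)%:E * n%:R%:E)%E).
      by apply: lee_wpmul2l; rewrite ?lee_fin ?invr_ge0 ?sqr_ge0//; exact: var_S.
    rewrite -EFinM lee_fin le_eqVlt; apply/orP; left; apply/eqP.
    by field; rewrite ?gt_eqF.
  apply: (@squeeze_cvge _ _ _ _ (cst 0%E) _
      (fun n => (n%:R^-1 * (e ^- 2))%:E)).
  - by near=> n; rewrite measure_ge0 h//; near: n; exists 1%N.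
  - exact: cvg_cst.
  - apply: cvg_EFin; first exact: nearW.
    rewrite -[X in _ --> X](mul0r (e ^- 2)); apply: cvgMr_tmp.
    rewrite gtr0_cvgV0; first exact: cvgr_idn.
    by near=> n; rewrite ltr0n; near: n; exists 1%N.
apply: filterS2 n_gt0 whpB => -[n w]/= n0 /negP; rewrite -ltNge => h.
have nR0 : 0 < n%:R :> R by rewrite ltr0n.
rewrite /avg -(ltr_pM2l nR0) -[X in X * `|_|]gtr0_norm// -normrM mulrBr mulrA divff ?gt_eqF//.
by rewrite mul1r; move: h; rewrite /S fct_sumE.
Unshelve. all: by end_near. Qed.

End events.

End weak_law.

(** * Algebra and order of averages *)

Section avg_lemmas.
Context (R : realType).
Implicit Types (u v : nat -> R) (n : nat) (a : R).

Lemma ler_avg n u v : (forall i, u i <= v i) -> avg n u <= avg n v.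
Proof. by move=> uv; rewrite ler_wpM2l ?invr_ge0// ler_sum. Qed.

Lemma avgD n u v : avg n (fun i => u i + v i) = avg n u + avg n v.
Proof. by rewrite /avg big_split mulrDr. Qed.

Lemma avgB n u v : avg n (fun i => u i - v i) = avg n u - avg n v.
Proof. by rewrite /avg sumrB mulrBr. Qed.

Lemma avgZ n a u : avg n (fun i => a * u i) = a * avg n u.
Proof. by rewrite /avg -mulr_sumr mulrCA. Qed.

Lemma avg_sum (I : Type) (r : seq I) n (f : I -> nat -> R) :
  avg n (fun i => \sum_(k <- r) f k i) = \sum_(k <- r) avg n (f k).
Proof. by rewrite /avg exchange_big mulr_sumr. Qed.

Lemma avg_cst n a : (0 < n)%N -> avg n (fun=> a) = a.
Proof.
move=> n0; rewrite /avg sumr_const card_ord -[a *+ n]mulr_natl mulrA mulVf ?mul1r//.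
by rewrite pnatr_eq0 -lt0n.
Qed.

Lemma avg_le_cst n u a : 0 <= a -> (forall i, u i <= a) -> avg n u <= a.
Proof.
case: n => [a0 _|n a0 ua]; first by rewrite /avg invr0 mul0r.
by rewrite -[leRHS](@avg_cst n.+1)// ler_avg.
Qed.

Lemma avg_ge0 n u : (forall i, 0 <= u i) -> 0 <= avg n u.
Proof. by move=> u0; rewrite mulr_ge0 ?invr_ge0// sumr_ge0. Qed.

End avg_lemmas.

(** * From events to functions with values in [0, 1] *)

Section quantization.
Context (R : realType).

(* Writes a [0, 1]-valued function as a mean of indicators up to [N%:R^-1], so
   that the weak law for events suffices. *)
Definition quantize (N : nat) (t : R) : R :=
  N%:R^-1 * \sum_(k < N) (k.+1%:R <= N%:R * t)%R%:R.

(** The number of thresholds met is the integer part of [N * t], which does not exceed [N] because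
    [t <= 1]. *)
Lemma quantize_bounds N t : (0 < N)%N -> 0 <= t <= 1 ->
  quantize N t <= t <= quantize N t + N%:R^-1.
Proof.
move=> N0 /andP[t0 t1].
have NR : 0 < N%:R :> R by rewrite ltr0n.
have Nt0 : 0 <= N%:R * t by rewrite mulr_ge0// ltW.
have /andP[lt1 lt2] := truncn_itv Nt0.
set m := Num.truncn (N%:R * t) in lt1 lt2.
have mN : (m <= N)%N.
  by rewrite -(ler_nat R) (le_trans lt1)// ler_piMr// ltW.
have -> : quantize N t = N%:R^-1 * m%:R.
  congr (_ * _).
  transitivity (\sum_(k < N) (if (k < m)%N then 1 else 0) : R).
    apply: eq_bigr => k _; rewrite -[in RHS](ltr_nat R).
    case: ifPn => km; case: leP => // h.
    - have : k.+1%:R <= m%:R :> R by rewrite ler_nat -(ltr_nat R).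
      by move=> /le_trans /(_ lt1); rewrite leNgt h.
    - have := le_lt_trans h lt2; rewrite ltr_nat ltnS => km'.
      by rewrite ltr_nat km' in km.
  by rewrite -big_mkcond/= (big_ord_narrow mN)/= sumr_const card_ord.
rewrite -[X in X + _]mulrC -[X in m%:R * _ + X]mul1r -mulrDl [X in X <= _]mulrC.
rewrite ler_pdivrMr// ler_pdivlMr// [t * _]mulrC lt1/=.
by rewrite natr1 ltW.
Qed.

End quantization.

Lemma integrable_01 d (T : measurableType d) (R : realType)
    (Q : probability T R) (h : T -> R) :
  measurable_fun setT h -> (forall x, 0 <= h x <= 1) ->
  Q.-integrable setT (EFin \o h).
Proof.
move=> mh h01; apply: measurable_bounded_integrable => //.
  by rewrite [X in (X < _)%E]probability_setT ltry.
exists 1; split => // M M1 x _ /=.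
have /andP[h0 h1] := h01 x.
by rewrite ger0_norm// (le_trans h1)// ltW.
Qed.

Section iid_weak_law.
Context d d' (T : measurableType d) (T' : measurableType d') (R : realType)
  (P : probability T R) (Z : {RV P >-> T'}) (Zs : nat -> {RV P >-> T'}).
Hypothesis Zs_iid : iid_copies P Z Zs.

Lemma iid_weak_law_set (B : set T') (e : R) : measurable B -> 0 < e ->
  \forall nw \near whp P,
    `|avg nw.1 (fun i => \1_B (Zs i nw.2)) - fine (distribution P Z B)| < e.
Proof.
move=> mB e0.
have mA i : measurable (Zs i @^-1` B).
  by rewrite -[_ @^-1` _]setTI; exact: measurable_funPT.
have PA i : P (Zs i @^-1` B) = (fine (distribution P Z B))%:E.
  rewrite fineK ?fin_num_measure//; exact: (Zs_iid.2 i).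
apply: (weak_law_events mA PA _ e0) => i j ij.
have := Zs_iid.1 [fset i; j]%fset (fun k => Zs k @^-1` B).
rewrite big_fsetU1/= ?big_seq_fset1 ?inE//.
rewrite (_ : \bigcap_(k in _) _ = Zs i @^-1` B `&` Zs j @^-1` B); last first.
  apply/seteqP; split => [w h|w [hi hj] k /=].
    by split; apply: h; rewrite /= !inE eqxx ?orbT.
  by rewrite !inE => /orP[/eqP->|/eqP->].
rewrite !PA -EFinM -expr2; apply => k _.
by exists B => //; rewrite setTI.
Qed.

(** The weak law holds for the [N] level sets [B k] simultaneously, with error [e / 3]. Quantization
    lowers the average and the integral by at most [1 / N < e / 3] each. *)
Lemma iid_weak_law (h : T' -> R) (e : R) :
  measurable_fun setT h -> (forall x, 0 <= h x <= 1) -> 0 < e ->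
  \forall nw \near whp P,
    `|avg nw.1 (fun i => h (Zs i nw.2)) - \int[distribution P Z]_x h x| < e.
Proof.
move=> mh h01 e0; pose Q := distribution P Z.
have e30 : 0 < e / 3 by rewrite divr_gt0.
have [N0 _ /(_ N0 (leqnn _))/= HN] := near_infty_natSinv_lt (PosNum e30).
set N := N0.+1 in HN.
pose B (k : nat) := [set x | k.+1%:R <= N%:R * h x].
have mB k : measurable (B k).
  rewrite -[B k]setTI; apply: measurable_fun_le => //.
  exact: measurable_funM.
have qE x : quantize N (h x) = N%:R^-1 * \sum_(k < N) \1_(B k) x.
  congr (_ * _); apply: eq_bigr => k _; rewrite indicE; congr (_%:R).
  by congr nat_of_bool; apply/idP/idP; rewrite inE.
pose q := N%:R^-1 * \sum_(k < N) fine (Q (B k)).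
have Qq : \int[Q]_x (N%:R^-1 * \sum_(k < N) \1_(B k) x) = q.
  have iB k : Q.-integrable setT (EFin \o \1_(B k)).
    apply: integrable_01 => [|x]; first exact: measurable_indic.
    by rewrite indicE; case: (_ \in _); rewrite !lexx ler01.
  have [iS QS] : Q.-integrable setT (EFin \o (fun x => \sum_(k < N) \1_(B k) x))
      /\ \int[Q]_x (\sum_(k < N) \1_(B k) x) = \sum_(k < N) fine (Q (B k)).
    elim: (N) => [|m [im IH]].
      split; last by under eq_Rintegral do rewrite big_ord0; rewrite Rintegral_cst// mul0r big_ord0.
      under [X in EFin \o X]eq_fun do rewrite big_ord0.
      exact: integrable0.
    under [X in EFin \o X]eq_fun do rewrite big_ord_recr.
    under eq_Rintegral do rewrite big_ord_recr.
    split; first exact: (integrableD measurableT im (iB m)).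
    rewrite RintegralD// IH big_ord_recr/=; congr (_ + _).
    by rewrite /Rintegral integral_indic// setIT.
  by rewrite RintegralZl// QS.
have mq : measurable_fun setT
    (fun x => N%:R^-1 * \sum_(k < N) \1_(B k) x : R).
  apply: measurable_funM => //; apply: measurable_sum => k.
  exact: measurable_indic.
have ih : Q.-integrable setT (EFin \o h) by exact: integrable_01.
have iq : Q.-integrable setT (EFin \o (fun x => N%:R^-1 * \sum_(k < N) \1_(B k) x)).
  apply: integrable_01 => // x; rewrite -qE.
  have /andP[_ h1] := h01 x; have /andP[qh _] := quantize_bounds (ltn0Sn N0) (h01 x).
  by rewrite (le_trans qh h1) mulr_ge0// ?invr_ge0// sumr_ge0.
have ic : Q.-integrable setT (EFin \o cst (N%:R^-1 : R)).
  exact: finite_measure_integrable_cst.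
have qhle : q <= \int[Q]_x h x.
  rewrite -Qq; apply: le_Rintegral => // x _; rewrite -qE.
  by have /andP[] := quantize_bounds (ltn0Sn N0) (h01 x).
have hqle : \int[Q]_x h x <= q + N%:R^-1.
  have -> : q + N%:R^-1 = \int[Q]_x (N%:R^-1 * \sum_(k < N) \1_(B k) x + N%:R^-1).
    rewrite RintegralD//.
    by rewrite Qq Rintegral_cst// [X in fine X]probability_setT mulr1.
  apply: le_Rintegral => //.
    exact: (integrableD measurableT iq ic).
  move=> x _; rewrite -qE.
  by have /andP[] := quantize_bounds (ltn0Sn N0) (h01 x).
have : \forall nw \near whp P, forall k : 'I_N,
    `|avg nw.1 (fun i => \1_(B k) (Zs i nw.2)) - fine (Q (B k))| < e / 3.
  by apply: filter_forall => k; exact: iid_weak_law_set.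
apply: filterS => -[n w]/= Hk.
set a := avg n _.
have aqle : avg n (fun i => quantize N (h (Zs i w))) <= a.
  by apply: ler_avg => i; have /andP[] := quantize_bounds (ltn0Sn N0) (h01 (Zs i w)).
have leaq : a <= avg n (fun i => quantize N (h (Zs i w))) + N%:R^-1.
  rewrite -lerBlDl -avgB; apply: avg_le_cst; first by rewrite invr_ge0.
  move=> i; have /andP[_] := quantize_bounds (ltn0Sn N0) (h01 (Zs i w)).
  by rewrite lerBlDl.
have : `|avg n (fun i => quantize N (h (Zs i w))) - q| <= e / 3.
  rewrite (_ : avg n _ = N%:R^-1 * \sum_(k < N) avg n (fun i => \1_(B k) (Zs i w))).
    rewrite -mulrBr -sumrB normrM ger0_norm ?invr_ge0//.
    rewrite ler_pdivrMl ?ltr0n// (le_trans (ler_norm_sum _ _ _))//.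
    rewrite mulr_natl -[N in leRHS]card_ord -sumr_const ler_sum// => k _.
    exact: ltW.
  by rewrite -avg_sum -avgZ; congr avg; apply/funext => i; rewrite qE.
move: HN aqle leaq qhle hqle; rewrite ler_norml ltr_norml => /=.
set u := avg n _; set v := N%:R^-1; set I := \int[_]_x _ => /=.
move=> ? ? ? ? ? /andP[? ?]; apply/andP; split; lra.
Qed.

End iid_weak_law.

(** * Polya's theorem: from pointwise to uniform closeness *)

Section onto_cdf.
Context (R : realType).

(** Surjectivity onto the open unit interval expresses continuity together with the limits 0 and 1
    at infinity, in the form in which it is applied: quantiles of every level exist. *)
Definition onto_cdf (F : R -> R) : Prop :=
  [/\ {homo F : x y / x <= y}, forall x, 0 <= F x <= 1 &
      forall p, 0 < p < 1 -> exists x, F x = p].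

(** Closeness at the finitely many quantiles of levels [k / N] suffices: in between, [F] varies
    little and [G i] is squeezed by monotonicity. The error is at most [e / 3 + 2 / N < e]. *)
Lemma polya (I : Type) (A : set_system I) (G : I -> R -> R) (F : R -> R) (e : R) :
  Filter A -> onto_cdf F ->
  (forall i, {homo G i : x y / x <= y}) -> (forall i x, 0 <= G i x <= 1) ->
  (forall x e, 0 < e -> \forall i \near A, `|G i x - F x| < e) ->
  0 < e -> \forall i \near A, forall x, `|G i x - F x| <= e.
Proof.
move=> FA [Fhomo F01 Fonto] Ghomo G01 GF e0.
have e30 : 0 < e / 3 by rewrite divr_gt0.
have [N0 _ /(_ N0 (leqnn _))/= HN] := near_infty_natSinv_lt (PosNum e30).
set N := N0.+1 in HN.
have NR : 0 < N%:R :> R by rewrite ltr0n.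
(* The levels 0 and 1 may not be attained; there the trivial bounds [0 <= G i x <= 1] replace a
   quantile, and [t 0] is arbitrary. *)
have /choice[t tE] (k : nat) : exists t, (0 < k < N)%N -> N%:R * F t = k%:R.
  have [kN|] := boolP (0 < k < N)%N; last by exists 0.
  have [|t Ft] := Fonto (k%:R / N%:R).
    by rewrite divr_gt0 ?ltr0n ?ltr_pdivrMr// ?mul1r ?ltr_nat; case/andP: kN => // -> ->.
  by exists t => _; rewrite Ft; field; rewrite gt_eqF.
have : \forall i \near A, forall k : 'I_N, `|G i (t k) - F (t k)| < e / 3.
  by apply: filter_forall => k; exact: GF.
apply: filterS => i Gt x.
have HN' : 1 < N%:R * (e / 3) by rewrite -ltr_pdivrMl// mulr1.
have /andP[F0 F1] := F01 x; have /andP[G0 G1] := G01 i x.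
have NF0 : 0 <= N%:R * F x by rewrite mulr_ge0// ltW.
have /andP[lt1 lt2] := truncn_itv NF0; set k := Num.truncn _ in lt1 lt2.
have kN : (k <= N)%N.
  by rewrite -(ler_nat R) (le_trans lt1)// ler_piMr// ltW.
rewrite -(ler_pM2l NR) -[X in X * `|_|]gtr0_norm// -normrM ler_norml.
rewrite mulrBr; apply/andP; split.
(* If [N * F x] equals [k], the quantile [t k] may lie to the right of [x], so the quantile of level
   [k - 1] is taken as the left neighbour. *)
- have [k1|k2] := leqP k 1.
    have : k%:R <= 1 :> R by rewrite (ler_nat R k 1).
    have : 0 <= N%:R * G i x by rewrite mulr_ge0// ltW.
    move: lt2; rewrite -natr1; lra.
  have k1N : (0 < k.-1 < N)%N by case: (k) k2 kN => [|[|m]].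
  have Ftk := tE _ k1N; have /andP[_ k1N'] := k1N.
  have ktx : t k.-1 <= x.
    rewrite leNgt; apply/negP => /ltW /Fhomo; rewrite -(ler_pM2l NR) Ftk.
    move=> /(le_trans lt1); rewrite ler_nat leqNgt => /negP; apply.
    by rewrite prednK// (ltn_trans _ k2).
  have := Gt (Ordinal k1N'); rewrite /= -(ltr_pM2l NR) -[X in X * `|_|]gtr0_norm// -normrM ltr_norml.
  rewrite mulrBr Ftk => /andP[h _].
  have : N%:R * G i (t k.-1) <= N%:R * G i x by rewrite ler_pM2l// Ghomo.
  have : k%:R = k.-1%:R + 1 :> R by rewrite natr1 prednK// (ltn_trans _ k2).
  move: lt2; rewrite -natr1; lra.
- have [k1N|Nk1] := ltnP k.+1 N; last first.
    have : N%:R <= k.+1%:R :> R by rewrite ler_nat.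
    have : N%:R * G i x <= N%:R by rewrite ler_piMr// ltW.
    move: lt1; rewrite -natr1; lra.
  have Ftk : N%:R * F (t k.+1) = k.+1%:R by apply: tE; rewrite k1N.
  have xkt : x <= t k.+1.
    rewrite leNgt; apply/negP => /ltW /Fhomo; rewrite -(ler_pM2l NR) Ftk.
    by rewrite leNgt lt2.
  have := Gt (Ordinal k1N); rewrite /= -(ltr_pM2l NR) -[X in X * `|_|]gtr0_norm// -normrM ltr_norml.
  rewrite mulrBr Ftk => /andP[_ h].
  have : N%:R * G i x <= N%:R * G i (t k.+1) by rewrite ler_pM2l// Ghomo.
  move: h lt1; rewrite -natr1; lra.
Qed.

End onto_cdf.

(** * Upper and lower bounds on the criterion *)

Section criterion_bounds.
Context (R : realType).
Implicit Types (n : nat) (ys : nat -> R) (G H : R -> R).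

(** The criterion as a real number, with an arbitrary [G] in place of the empirical convolution;
    [criterionE] makes the link. *)
Definition sq_dist n ys G : R :=
  avg n (fun j => (empirical_cdf n ys (ys j) - G (ys j)) ^+ 2).

Lemma empirical_cdfE n ys y :
  empirical_cdf n ys y = avg n (fun i => (ys i <= y)%R%:R).
Proof. by []. Qed.

Lemma empirical_cdf_homo n ys : {homo empirical_cdf n ys : x y / x <= y}.
Proof.
move=> x y xy; rewrite !empirical_cdfE; apply: ler_avg => i; case: (leP (ys i) x) => //= h.
by rewrite (le_trans h xy).
Qed.

Lemma empirical_cdf01 n ys y : 0 <= empirical_cdf n ys y <= 1.
Proof.
rewrite empirical_cdfE; apply/andP; split.
  by apply: avg_ge0 => i; exact: ler0n.
by apply: avg_le_cst => // i; rewrite lern1 leq_b1.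
Qed.

Lemma sq_dist_le n ys G e : 0 <= e ->
  (forall y, `|empirical_cdf n ys y - G y| <= e) -> sq_dist n ys G <= e ^+ 2.
Proof.
move=> e0 EG; apply: avg_le_cst; first exact: sqr_ge0.
by move=> i; rewrite -real_normK ?num_real// lerXn2r// nnegrE.
Qed.

(** Each sample point in []a, b]] contributes at least [e ^+ 2] to the average, and the empirical
    mass of this interval is the difference on the left. *)
Lemma sq_dist_ge_gap n ys G a b e : 0 <= e ->
  (forall y, a < y -> y <= b -> e <= `|empirical_cdf n ys y - G y|) ->
  (empirical_cdf n ys b - empirical_cdf n ys a) * e ^+ 2 <= sq_dist n ys G.
Proof.
move=> e0 gap.
rewrite !empirical_cdfE -avgB mulrC -avgZ; apply: ler_avg => j.
have [yb|yb] := leP (ys j) b; have [ya|ya] := leP (ys j) a => /=.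
- by rewrite subrr mulr0 sqr_ge0.
- rewrite subr0 mulr1 -[leRHS]real_normK ?num_real// lerXn2r ?nnegrE//.
  exact: gap.
(* This case occurs only if [b < a]; the point then counts negatively on the left. *)
- by rewrite sub0r mulrN1 (le_trans _ (sqr_ge0 _))// oppr_le0 sqr_ge0.
- by rewrite subrr mulr0 sqr_ge0.
Qed.

(* Choose by surjectivity a point where [H] is half way between [H y0] and
   [G y0]; by monotonicity the gap persists between it and [y0], and this
   interval carries empirical mass. *)
Lemma sq_dist_ge n ys G H e y0 : 0 < e -> onto_cdf H ->
  {homo G : x y / x <= y} -> (forall y, 0 <= G y <= 1) ->
  (forall y, `|empirical_cdf n ys y - H y| <= e) ->
  8 * e <= `|H y0 - G y0| -> 18 * e ^+ 3 <= sq_dist n ys G.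
Proof.
move=> e0 [Hhomo H01 Honto] Ghomo G01 EH gap.
have EHl y : H y - e <= empirical_cdf n ys y.
  by have := EH y; rewrite ler_norml => /andP[+ _]; lra.
have EHr y : empirical_cdf n ys y <= H y + e.
  by have := EH y; rewrite ler_norml => /andP[_]; lra.
have /andP[H0 H1] := H01 y0; have /andP[G0 G1] := G01 y0.
(* An increase of [H] by [4 * e] leaves empirical mass at least [2 * e]. Of the gap [8 * e], moving
   half way costs [4 * e] and passing from [H] to the empirical function costs [e], which leaves
   [3 * e]. *)
suff [a [b [Hab]]] : exists a b, H b - H a >= 4 * e /\
    forall y, a < y -> y <= b -> 3 * e <= `|empirical_cdf n ys y - G y|.
  move=> /sq_dist_ge_gap h; apply: le_trans (h _); last by rewrite mulr_ge0// ltW.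
  have -> : 18 * e ^+ 3 = (2 * e) * (3 * e) ^+ 2 by ring.
  by rewrite ler_wpM2r ?sqr_ge0//; have := EHl b; have := EHr a; lra.
have [GH|HG] := leP (G y0) (H y0).
  rewrite ger0_norm ?subr_ge0// in gap.
  have [|y1 Hy1] := Honto (H y0 - 4 * e); first by apply/andP; split; lra.
  exists y1, y0; split; first by lra.
  move=> y y1y yy0; have := Ghomo _ _ yy0; have := Hhomo _ _ (ltW y1y).
  by move=> ? ?; rewrite (le_trans _ (ler_norm _))//; have := EHl y; lra.
rewrite ltr0_norm ?subr_lt0// in gap.
have [|y1 Hy1] := Honto (H y0 + 4 * e); first by apply/andP; split; lra.
exists y0, y1; split; first by lra.
move=> y y0y yy1; have := Ghomo _ _ (ltW y0y); have := Hhomo _ _ yy1.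
by move=> ? ?; rewrite -normrN (le_trans _ (ler_norm _))//; have := EHr y; lra.
Qed.

Lemma criterionE (k n : nat) (F : R -> R) (xs : nat -> 'rV[R]_k) ys b :
  {homo F : x y / x <= y} ->
  criterion n F xs ys b =
  (sq_dist n ys (fun y => avg n (fun i => F (y - dotv b (xs i)))))%:E.
Proof.
move=> Fhomo; rewrite /criterion /empirical_measure.
set f := fun y => (_ ^+ 2)%:E.
have mf : measurable_fun setT f.
  apply/measurable_EFinP/measurable_funX/measurable_funB.
    by apply: nondecreasing_measurable => //; exact: empirical_cdf_homo.
  apply: nondecreasing_measurable => // y z yz.
  rewrite ler_wpM2l ?invr_ge0// ler_sum// => i _.
  by apply: Fhomo; rewrite lerB.
have f0 y : (0 <= f y)%E by rewrite lee_fin sqr_ge0.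
rewrite ge0_integral_mscale//; last by move=> x _; exact: f0.
pose g j := (empirical_cdf n ys (ys j)
  - avg n (fun i => F (ys j - dotv b (xs i)))) ^+ 2.
transitivity ((n%:R^-1)%:E * (\sum_(j < n) g j)%:E)%E => //.
rewrite -sumEFin; congr (_ * _)%E.
transitivity (\sum_(j < n) \int[\d_(ys j)]_y f y)%E.
  have /= h := @ge0_integral_measure_sum _ _ _ (fun i => \d_(ys i)) setT measurableT f.
  by apply: h.
by apply: eq_bigr => j _; rewrite integral_dirac// diracT mul1e.
Qed.

End criterion_bounds.

(** * Continuity and measurability of the scalar product *)

Lemma continuous_sumr (R : realType) (U : topologicalType) (I : Type)
    (r : seq I) (f : I -> U -> R) :
  (forall i, continuous (f i)) -> continuous (fun x => \sum_(i <- r) f i x).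
Proof.
move=> cf; elim: r => [|i r IH] x.
  by under [X in continuous_at _ X]eq_fun do rewrite big_nil; exact: cvg_cst.
under [X in continuous_at _ X]eq_fun do rewrite big_cons.
by apply: cvgD; [exact: cf|exact: IH].
Qed.

Section dot_product.
Context (R : realType) (k : nat).
Implicit Types a b x : 'rV[R]_k.

(** The norm dual to the sup norm, so that [dotv_dist] is Hoelder's inequality. *)
Definition norm1 x : R := \sum_(j < k) `|x 0 j|.

Lemma norm1_ge0 x : 0 <= norm1 x.
Proof. by rewrite sumr_ge0. Qed.

Lemma ler_coord_norm x j : `|x 0 j| <= `|x|.
Proof.
rewrite [leRHS]/Num.norm /= mx_normrE.
by apply/bigmax_geP; right => /=; exists (0, j).
Qed.

Lemma dotv_dist a b x : `|dotv a x - dotv b x| <= `|a - b| * norm1 x.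
Proof.
rewrite /dotv -sumrB mulr_sumr (le_trans (ler_norm_sum _ _ _))// ler_sum// => j _.
rewrite -mulrBl normrM ler_wpM2r//.
by have := ler_coord_norm (a - b) j; rewrite !mxE.
Qed.

Lemma dotvZ (s : R) a x : dotv (s *: a) x = s * dotv a x.
Proof. by rewrite /dotv mulr_sumr; apply: eq_bigr => j _; rewrite mxE mulrA. Qed.

Lemma continuous_dotvl x : continuous (fun b => dotv b x).
Proof.
apply: continuous_sumr => j b.
exact: (cvgM (@coord_continuous R 1 k 0 j b) (cvg_cst (x 0 j))).
Qed.

Lemma continuous_dotv b : continuous (dotv b).
Proof.
apply: continuous_sumr => j x.
exact: (cvgM (cvg_cst (b 0 j)) (@coord_continuous R 1 k 0 j x)).
Qed.

Lemma continuous_norm1 : continuous norm1.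
Proof. by apply: continuous_sumr => j x; exact: (cvg_norm (@coord_continuous R 1 k 0 j x)). Qed.

Lemma continuous_borel_measurable (f : 'rV[R]_k -> R) :
  continuous f -> measurable_fun setT (f : borel_rV R k -> R).
Proof.
move=> cf; apply: (measurability _ (RGenOpens.measurableE R)).
move=> _ [_ [a [b ->] <-]]; rewrite setTI; apply: sub_sigma_algebra.
by move/continuousP : cf; apply; exact: interval_open.
Qed.

End dot_product.

(** * Distribution functions of real random variables *)

Section cdf_facts.
Context d (T : measurableType d) (R : realType) (P : probability T R)
  (Z : {RV P >-> R}).

Lemma EFin_cdfR y : (cdfR Z y)%:E = cdf Z y.
Proof. by rewrite /cdfR fineK// fin_num_measure. Qed.

Lemma cdfR_homo : {homo cdfR Z : x y / x <= y}.
Proof. by move=> x y xy; rewrite -lee_fin !EFin_cdfR cdf_nondecreasing. Qed.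

Lemma cdfR01 y : 0 <= cdfR Z y <= 1.
Proof. by rewrite -!lee_fin EFin_cdfR cdf_ge0 cdf_le1. Qed.

Lemma onto_cdfR : continuous (cdfR Z) -> onto_cdf (cdfR Z).
Proof.
move=> cZ; split; [exact: cdfR_homo|exact: cdfR01|move=> p /andP[p0 p1]].
have [a ap] : exists a, cdfR Z a < p.
  have h : cdfR Z x @[x --> -oo%R] --> (0 : R).
    by apply: fine_cvg; exact: cvg_cdfNy0.
  exact: (filter_ex (cvgr_lt _ h _ p0)).
have [b pb] : exists b, p < cdfR Z b.
  have h : cdfR Z x @[x --> +oo%R] --> (1 : R).
    by apply: fine_cvg; exact: cvg_cdfy1.
  exact: (filter_ex (cvgr_gt _ h _ p1)).
have ab : a <= b.
  by rewrite leNgt; apply/negP => /ltW /cdfR_homo; rewrite leNgt (lt_trans ap pb).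
have [||c _ cp] := @IVT R (cdfR Z) a b p ab; last by exists c.
- exact: continuous_subspaceT.
- by rewrite ge_min le_max (ltW ap) (ltW pb) orbT.
Qed.

(** On [[y - 1, y + 1]] the distribution function is a constant plus the integral of the density
    from [y - 1], which is continuous in its upper limit. *)
Lemma has_density_continuous : has_density Z -> continuous (cdfR Z).
Proof.
move=> [f [mf f0 fE]] y.
have fle b : lebesgue_measure.-integrable `]-oo, b] (EFin \o f).
  apply/integrableP; split; first exact/measurable_EFinP/measurable_funTS.
  under eq_integral do rewrite /= ger0_norm//.
  by rewrite -fE (le_lt_trans (cdf_le1 _ _))// ltry.
have yy : y - 1 < y + 1 by lra.
have fab : lebesgue_measure.-integrable `[y - 1, y + 1] (EFin \o f).
  by apply: integrableS (fle (y + 1)) => //; exact: subset_itvr.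
have := parameterized_integral_continuous (ltW yy) fab.
move=> /(continuous_within_itvP _ yy)[/(_ y) + _ _].
rewrite in_itv/= => /(_ _) cI.
set I := fun x => parameterized_integral lebesgue_measure (y - 1) x f in cI.
have FE x : y - 1 <= x -> x <= y + 1 ->
    cdfR Z x = \int[lebesgue_measure]_(t in `]-oo, (y - 1)[) f t + I x.
  move=> yx xy; rewrite /cdfR fE.
  have itvU : `]-oo, x]%classic = `]-oo, (y - 1)[ `|` `[y - 1, x] :> set R.
    by rewrite -itv_bndbnd_setU// bnd_simp.
  transitivity (\int[lebesgue_measure]_(t in `]-oo, x]) f t) => //.
  rewrite itvU Rintegral_setU//.
  - by rewrite -itvU; exact: fle.
  - apply/disj_setPS => t [] /=; rewrite !in_itv/= => ty /andP[yt _].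
    by move: ty; rewrite ltNge yt.
have {}cI : I x @[x --> y] --> I y by apply: cI; apply/andP; split; lra.
rewrite /continuous_at FE ?gerBl ?lerDl//.
apply: cvg_trans; last first.
  exact: (cvgD (cvg_cst _) cI).
apply: near_eq_cvg; near=> x; rewrite FE//; apply: ltW; near: x.
  by apply: lt_nbhsr; lra.
by apply: lt_nbhsl; lra.
Unshelve. all: by end_near. Qed.

End cdf_facts.

(** * The convolution as the distribution function of a sum *)

Section convolution.
Context d (T : measurableType d) (R : realType) (P : probability T R) (k : nat)
  (X : {RV P >-> borel_rV R k}) (eps Y : {RV P >-> R}).

(** By independence and uniqueness of the product measure, the joint law of [X] and [eps] is the
    product of their laws. The section at [x] of the event is the half-line up to [y - dotv b x]. *)
Lemma convolution_independent b y :
  independent_systems P (sigma_of eps) (sigma_of X) ->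
  P [set w | dotv b (X w) + eps w <= y] = convolved_cdf X (cdfR eps) b y.
Proof.
move=> indep.
have mdot : measurable_fun setT (dotv b : borel_rV R k -> R).
  by apply: continuous_borel_measurable; exact: continuous_dotv.
have mXe : measurable_fun setT (fun w => (X w, eps w)).
  exact: measurable_fun_pair.
pose Xe : {RV P >-> (borel_rV R k * R)%type} :=
  HB.pack (fun w => (X w, eps w)) (isMeasurableFun.Build _ _ _ _ _ mXe).
pose S : set (borel_rV R k * R) := [set xv | dotv b xv.1 + xv.2 <= y].
have mS : measurable S.
  rewrite -[S]setTI; apply: measurable_fun_le => //.
  apply: measurable_funD; last exact: measurable_snd.
  exact: (measurableT_comp mdot measurable_fst).
transitivity (distribution P Xe S) => //.
rewrite -(@product_measure_unique _ _ _ _ _ (distribution P X) (distribution P eps)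
  (distribution P Xe) _ S mS); last first.
  move=> A B mA mB; rewrite muleC.
  have := indep (eps @^-1` B) (X @^-1` A).
  rewrite setIC; apply; first by exists B => //; rewrite setTI.
  by exists A => //; rewrite setTI.
rewrite /product_measure1/=; apply: eq_integral => x _.
rewrite EFin_cdfR /cdf; congr (distribution P eps _).
apply/seteqP; split => v /=; rewrite /xsection/= in_itv/= ?inE /S/= lerBrDl//.
Qed.

End convolution.

(** * The empirical convolution, locally and on compact sets *)

Section empirical_convolution.
Context d (T : measurableType d) (R : realType) (P : probability T R) (k : nat)
  (X : {RV P >-> borel_rV R k}) (Xs : nat -> {RV P >-> borel_rV R k})
  (F : R -> R).
Hypothesis Xs_iid : iid_copies P X Xs.
Hypothesis F_continuous : continuous F.
Hypothesis F_onto : onto_cdf F.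

Let Fhomo : {homo F : x y / x <= y}. Proof. by case: F_onto. Qed.
Let F01 x : 0 <= F x <= 1. Proof. by case: F_onto. Qed.

(* The real-valued [convolved_cdf]. *)
Definition conv_cdf (b : 'rV[R]_k) (y : R) : R :=
  \int[distribution P X]_x F (y - dotv b x).

Definition empirical_conv (n : nat) (w : T) (b : 'rV[R]_k) (y : R) : R :=
  avg n (fun i => F (y - dotv b (Xs i w))).

(** For [s >= 0], the shift [s * norm1 x] is the most that [dotv b x] can change when [b] moves by
    [s] in the sup norm. A negative [s] gives the lower bracket. *)
Let widened b y s (x : borel_rV R k) : R := F (y - dotv b x + s * norm1 x).

Let measurable_widened b y s : measurable_fun setT (widened b y s).
Proof.
apply: continuous_borel_measurable => x.
have h := cvgD (cvgB (cvg_cst y) (@continuous_dotv R k b x))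
  (cvgM (cvg_cst s) (@continuous_norm1 R k x)).
apply: (@continuous_comp 'rV[R]_k R R
  (fun z => y - dotv b z + s * norm1 z) F); last exact: F_continuous.
exact: h.
Qed.

Let widened0 b y x : widened b y 0 x = F (y - dotv b x).
Proof. by rewrite /widened mul0r addr0. Qed.

Lemma convolved_cdfE b y : convolved_cdf X F b y = (conv_cdf b y)%:E.
Proof.
rewrite /convolved_cdf /conv_cdf /Rintegral fineK//.
apply: integrable_fin_num => //; apply: integrable_01 => //.
by under eq_fun do rewrite -widened0; exact: measurable_widened.
Qed.

Lemma empirical_conv_homo n w b : {homo empirical_conv n w b : x y / x <= y}.
Proof. by move=> x y xy; apply: ler_avg => i; apply: Fhomo; rewrite lerB. Qed.

Lemma empirical_conv01 n w b y : 0 <= empirical_conv n w b y <= 1.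
Proof.
apply/andP; split.
  by apply: avg_ge0 => i; case/andP: (F01 (y - dotv b (Xs i w))).
by apply: avg_le_cst => // i; case/andP: (F01 (y - dotv b (Xs i w))).
Qed.

Lemma continuous_empirical_conv n w y :
  continuous (fun b => empirical_conv n w b y).
Proof.
have cF (i : 'I_n) : continuous (fun b => F (y - dotv b (Xs i w))).
  move=> b; apply: (@continuous_comp 'rV[R]_k R R
    (fun b => y - dotv b (Xs i w)) F); last exact: F_continuous.
  exact: (cvgB (cvg_cst y) (@continuous_dotvl R k (Xs i w) b)).
move=> b; exact: (cvgMl_tmp (@continuous_sumr _ _ _ (index_enum _) _ cF b)).
Qed.

Lemma empirical_conv_cvg b y e : 0 < e ->
  \forall nw \near whp P, `|empirical_conv nw.1 nw.2 b y - conv_cdf b y| < e.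
Proof.
move=> e0; apply: (iid_weak_law Xs_iid) => //.
by under eq_fun do rewrite -widened0; exact: measurable_widened.
Qed.

(** Dominated convergence with bound 1. A varying [z] with [s = 0] gives continuity of [conv_cdf b];
    a fixed [z] with [s] tending to 0 gives tight brackets. *)
Let widened_cvg b (z s : nat -> R) y :
  z n @[n --> \oo] --> y -> s n @[n --> \oo] --> 0 ->
  \int[distribution P X]_x widened b (z n) (s n) x @[n --> \oo] --> conv_cdf b y.
Proof.
move=> zy s0; apply: fine_cvg.
have := convolved_cdfE b y; rewrite /convolved_cdf => <-.
have [//| | | | | _ _] := @dominated_convergence _ _ _ (distribution P X) setT
  measurableT (fun n x => (widened b (z n) (s n) x)%:E)
  (fun x => (F (y - dotv b x))%:E) (cst 1%E) _ _ _ _ _.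
- by move=> n; apply/measurable_EFinP; exact: measurable_widened.
- apply/measurable_EFinP.
  by under eq_fun do rewrite -widened0; exact: measurable_widened.
- apply: aeW => x _; apply: cvg_EFin; first exact: nearW.
  have h : z n - dotv b x + s n * norm1 x @[n --> \oo] --> y - dotv b x + 0 * norm1 x.
    exact: (cvgD (cvgB zy (cvg_cst _)) (cvgMr_tmp s0)).
  rewrite -widened0; have h2 : F (z n - dotv b x + s n * norm1 x) @[n --> \oo] -->
      F (y - dotv b x + 0 * norm1 x).
    by apply: cvg_comp; [exact: h|exact: F_continuous].
  exact: h2.
- exact: finite_measure_integrable_cst.
- apply: aeW => x n _ /=; rewrite lee_fin ger0_norm.
    by case/andP: (F01 (z n - dotv b x + s n * norm1 x)).
  by case/andP: (F01 (z n - dotv b x + s n * norm1 x)).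
- by [].
Qed.

Lemma continuous_conv_cdf b : continuous (conv_cdf b).
Proof.
move=> y; apply/(@cvg_nbhsP _ R^o) => z zy.
have h := @widened_cvg b _ _ _ zy (cvg_cst 0).
have zE n : \int[distribution P X]_x widened b (z n) 0 x = conv_cdf b (z n).
  by apply: eq_Rintegral => x _; rewrite widened0.
by rewrite (funext zE) in h; exact: h.
Qed.

(* For [b'] within [r] of [b], [F (y - b'.x)] lies between the values of
   [widened b y] at [- r] and [r], whose averages obey the weak law. *)
Lemma empirical_conv_near b y e : 0 < e ->
  \forall b' \near b & nw \near whp P,
    `|empirical_conv nw.1 nw.2 b' y - conv_cdf b y| < e.
Proof.
move=> e0; have e20 : 0 < e / 2 by rewrite divr_gt0.
have hu : \int[distribution P X]_x widened b y (n.+1%:R^-1) x @[n --> \oo] --> conv_cdf b y.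
  by apply: widened_cvg; [exact: cvg_cst|exact: cvg_harmonic].
have hl : \int[distribution P X]_x widened b y (- n.+1%:R^-1) x @[n --> \oo] --> conv_cdf b y.
  by apply: widened_cvg; [exact: cvg_cst|rewrite -oppr0]; apply: cvgN; exact: cvg_harmonic.
have [r r0 [ur lr]] : exists2 r, 0 < r &
    \int[distribution P X]_x widened b y r x < conv_cdf b y + e / 2 /\
    conv_cdf b y - e / 2 < \int[distribution P X]_x widened b y (- r) x.
  have hu' : conv_cdf b y < conv_cdf b y + e / 2 by rewrite ltrDl.
  have hl' : conv_cdf b y - e / 2 < conv_cdf b y by rewrite ltrBlDr ltrDl.
  have [n [h1 h2]] := filter_ex (filterI (cvgr_lt _ hu _ hu') (cvgr_gt _ hl _ hl')).
  by exists n.+1%:R^-1; [rewrite invr_gt0|split].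
have Wu := iid_weak_law Xs_iid (measurable_widened b y r) (fun=> F01 _) e20.
have Wl := iid_weak_law Xs_iid (measurable_widened b y (- r)) (fun=> F01 _) e20.
exists (ball b r, [set nw |
  `|avg nw.1 (fun i => widened b y r (Xs i nw.2)) - \int[distribution P X]_x widened b y r x| < e / 2 /\
  `|avg nw.1 (fun i => widened b y (- r) (Xs i nw.2)) - \int[distribution P X]_x widened b y (- r) x| < e / 2]).
  by split => /=; [exact: nbhsx_ballx|exact: filterI Wu Wl].
move=> [b' [n w]]/= [bb' [Hu Hl]].
have dist i : `|dotv b' (Xs i w) - dotv b (Xs i w)| <= r * norm1 (Xs i w).
  rewrite (le_trans (dotv_dist _ _ _))// ler_wpM2r ?norm1_ge0// ltW//.
  by rewrite distrC; move: bb'; rewrite -ball_normE.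
have le_u : empirical_conv n w b' y <= avg n (fun i => widened b y r (Xs i w)).
  apply: ler_avg => i; apply: Fhomo.
  by have := dist i; rewrite ler_norml => /andP[+ _]; lra.
have le_l : avg n (fun i => widened b y (- r) (Xs i w)) <= empirical_conv n w b' y.
  apply: ler_avg => i; apply: Fhomo.
  by have := dist i; rewrite ler_norml => /andP[_ +]; lra.
by move: Hu Hl; rewrite !ltr_norml => /andP[_ ?] /andP[? _]; apply/andP; split; lra.
Qed.

(** The point [y] that separates [b] also serves all nearby [b'], with at least half the gap.
    Treating the size of the gap as a second index, tending to 0 from the right, lets compactness
    choose one [e] for all of [K]. *)
Lemma empirical_conv_gap_compact (H : R -> R) (K : set 'rV[R]_k) :
  compact K -> (forall b, K b -> exists y, H y != conv_cdf b y) ->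
  exists2 e, 0 < e & \forall nw \near whp P, forall b, K b ->
    exists y, e <= `|H y - empirical_conv nw.1 nw.2 b y|.
Proof.
move=> /compact_near_coveringP cK KH.
pose gap (i : (nat * T) * R) b :=
  exists y, i.2 <= `|H y - empirical_conv i.1.1 i.1.2 b y|.
have /(cK _ (filter_prod (whp P) (0 : R)^'+) gap _)[[A B]/= [WA NB] AB] :
    forall b, K b -> \forall b' \near b & i \near filter_prod (whp P) (0 : R)^'+, gap i b'.
  move=> b Kb; have [y Hy] := KH b Kb.
  set g := `|H y - conv_cdf b y|.
  have g20 : 0 < g / 2 by rewrite divr_gt0// normr_gt0 subr_eq0.
  have [[U V]/= [NU WV] UV] := empirical_conv_near b y g20.
  exists (U, V `*` [set e | e < g / 2]).
    split => //=; exists (V, [set e | e < g / 2]) => //=; split => //=.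
    exact: nbhs_right_lt.
  move=> [b' [nw e]]/= [Ub' [Vnw eg]]; exists y.
  have := UV (b', nw) (conj Ub' Vnw).
  have := ler_distD (empirical_conv nw.1 nw.2 b' y) (H y) (conv_cdf b y).
  by rewrite -/g /=; move: eg; lra.
have [e [e0 Be]] := filter_ex (filterI (nbhs_right_gt (0 : R)) NB).
exists e => //; apply: filterS WA => nw Anw b Kb.
exact: (AB (nw, e) (conj Anw Be)).
Qed.

(** * Large regression vectors *)

Section slabs.
Hypothesis no_hyperplane : forall a : 'rV[R]_k, a != 0 ->
  P [set w | dotv a (X w) = 0] = 0%E.

(** The term [r * norm1 x] makes this one set contain every strip where [dotv a' x] is at most [r]
    in absolute value, for [a'] within [r] of [a]. *)
Let slab a r := [set x : borel_rV R k | `|dotv a x| <= r * (1 + norm1 x)].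

Let measurable_slab a r : measurable (slab a r).
Proof.
have mdot : measurable_fun setT (dotv a : borel_rV R k -> R).
  by apply: continuous_borel_measurable; exact: continuous_dotv.
have mnorm : measurable_fun setT (@norm1 R k : borel_rV R k -> R).
  by apply: continuous_borel_measurable; exact: continuous_norm1.
rewrite -[slab a r]setTI; apply: measurable_fun_le => //.
  exact: measurableT_comp.
by apply: measurable_funM => //; exact: measurable_funD.
Qed.

(** The slabs decrease to a subset of the hyperplane orthogonal to [a], which is null; continuity of
    the measure from above concludes. *)
Let small_slab a e : a != 0 -> 0 < e ->
  exists2 r, 0 < r & fine (distribution P X (slab a r)) < e.
Proof.
move=> a0 e0; pose Q : probability (borel_rV R k) R := distribution P X.
pose S n := slab a n.+1%:R^-1.
have S0 : \bigcap_n S n `<=` [set x | dotv a x = 0].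
  move=> x Sx /=; apply/eqP; rewrite -normr_le0.
  have h : n.+1%:R^-1 * (1 + norm1 x) @[n --> \oo] --> 0 * (1 + norm1 x).
    by apply: cvgMr_tmp; exact: cvg_harmonic.
  rewrite -[leRHS](mul0r (1 + norm1 x)).
  by apply: (cvgr_to_ge h); apply: nearW => n; exact: Sx.
have mH : measurable [set x : borel_rV R k | dotv a x = 0].
  rewrite -[mkset _]setTI.
  exact: (continuous_borel_measurable (@continuous_dotv R k a) measurableT (measurable_set1 0)).
have mS : measurable (\bigcap_n S n).
  by apply: bigcap_measurable => // n _; exact: measurable_slab.
have QS : Q (\bigcap_n S n) = 0%E.
  apply/eqP; rewrite -measure_le0.
  have <- : Q [set x | dotv a x = 0] = 0%E by exact: no_hyperplane.
  by rewrite le_measure ?inE.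
have : Q (S n) @[n --> \oo] --> 0%E.
  rewrite -QS; apply: nonincreasing_cvg_mu => //.
  - by rewrite (le_lt_trans (probability_le1 _ _)) ?ltry//; exact: measurable_slab.
  - by move=> n; exact: measurable_slab.
  - move=> n m nm; apply/subsetPset => x /= /le_trans; apply.
    rewrite ler_wpM2r ?addr_ge0 ?norm1_ge0// lef_pV2 ?posrE// ler_nat.
    by rewrite ltnS.
move=> /fine_cvg h; have [n hn] := filter_ex (cvgr_lt _ h _ e0).
by exists n.+1%:R^-1; first rewrite invr_gt0.
Qed.

(** The weak law for one slab controls all nearby directions and all smaller widths; compactness of
    the unit sphere then yields a common [r]. *)
Lemma small_slab_sphere e : 0 < e -> exists2 r, 0 < r &
  \forall nw \near whp P, forall a : 'rV[R]_k, `|a| = 1 ->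
    avg nw.1 (fun i => (`|dotv a (Xs i nw.2)| <= r)%R%:R : R) < e.
Proof.
move=> e0; have e20 : 0 < e / 2 by rewrite divr_gt0.
have cS : compact [set a : 'rV[R]_k | `|a| = 1].
  apply: bounded_closed_compact.
    by exists 1; split => // M M1 a /= ->; exact: ltW.
  rewrite (_ : mkset _ = (fun a => `|a|) @^-1` [set 1])//.
  apply: closed_comp; last exact: closed_eq.
  by move=> a _; exact: norm_continuous.
pose small (i : (nat * T) * R) (a : 'rV[R]_k) :=
  avg i.1.1 (fun j => (`|dotv a (Xs j i.1.2)| <= i.2)%R%:R : R) < e.
have /((compact_near_coveringP _).1 cS _ (filter_prod (whp P) (0 : R)^'+) small _)[[A B]/= [WA NB] AB] :
    forall a : 'rV[R]_k, `|a| = 1 ->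
    \forall a' \near a & i \near filter_prod (whp P) (0 : R)^'+, small i a'.
  move=> a /= a1; have a0 : a != 0 by rewrite -normr_eq0 a1 oner_eq0.
  have [r r0 hr] := small_slab a0 e20.
  have W := iid_weak_law_set Xs_iid (measurable_slab a r) e20.
  exists (ball a r, [set nw | `|avg nw.1 (fun i => \1_(slab a r) (Xs i nw.2)) -
      fine (distribution P X (slab a r))| < e / 2] `*` [set s | s < r]).
    split => /=; first exact: nbhsx_ballx.
    exists ([set nw | `|avg nw.1 (fun i => \1_(slab a r) (Xs i nw.2)) -
      fine (distribution P X (slab a r))| < e / 2], [set s | s < r]) => //=.
    by split => //=; exact: nbhs_right_lt.
  move=> [a' [[n w] s]]/= [aa' [Hn sr]]; rewrite /small/=.
  apply: (@le_lt_trans _ _ (avg n (fun i => \1_(slab a r) (Xs i w)))); last first.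
    by move: Hn; rewrite ltr_norml => /andP[_]; lra.
  apply: ler_avg => i; rewrite indicE.
  case: (leP `|dotv a' (Xs i w)| s) => h; last exact: ler0n.
  rewrite mem_set// /slab/=.
  have := dotv_dist a a' (Xs i w).
  have : `|a - a'| * norm1 (Xs i w) <= r * norm1 (Xs i w).
    rewrite ler_wpM2r ?norm1_ge0// ltW//.
    by move: aa'; rewrite -ball_normE.
  have := ler_normD (dotv a (Xs i w) - dotv a' (Xs i w)) (dotv a' (Xs i w)).
  by rewrite subrK mulrDr mulr1; lra.
have [r [r0 Br]] := filter_ex (filterI (nbhs_right_gt (0 : R)) NB).
exists r => //; apply: filterS WA => nw Anw a a1.
exact: (AB (nw, r) (conj Anw Br)).
Qed.

(** Between its quantiles [y1] and [y2], [H] rises by 3/4, whereas the empirical convolution rises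
    by at most 3/8: 1/8 from each term, plus 1/4 for the few terms with small [dotv a]. Gaps below
    1/8 at both points would force a rise above 1/2. *)
Lemma empirical_conv_gap_infty (H : R -> R) : onto_cdf H ->
  exists M, \forall nw \near whp P, forall b : 'rV[R]_k, M <= `|b| ->
    exists y, 1 / 8 <= `|H y - empirical_conv nw.1 nw.2 b y|.
Proof.
move=> [_ _ Honto]; have [_ _ Fonto] := F_onto.
have p18 : 0 < (1 / 8 : R) < 1 by lra.
have p78 : 0 < (7 / 8 : R) < 1 by lra.
have [y1 Hy1] := Honto _ p18; have [y2 Hy2] := Honto _ p78.
have [z1 Fz1] := Fonto _ p18; have [z2 Fz2] := Fonto _ p78.
(* A shift by at least [U] sends both [y1 - u] and [y2 - u] to the left of [z1] or both to the right
   of [z2], where [F] varies by at most 1/8. *)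
pose U : R := `|y2 - z1| + `|z2 - y1|.
have FU u : U <= `|u| -> F (y2 - u) - F (y1 - u) <= 1 / 8.
  rewrite /U; have := ler_norm (y2 - z1); have := ler_norm (z2 - y1).
  have := normr_ge0 (y2 - z1); have := normr_ge0 (z2 - y1).
  have /andP[F2 F2'] := F01 (y2 - u); have /andP[F1 F1'] := F01 (y1 - u).
  have [u0|u0] := leP 0 u => ? ? ? ?; [rewrite (ger0_norm u0)|rewrite (ltr0_norm u0)] => uU.
    by have : F (y2 - u) <= F z1; [apply: Fhomo|]; lra.
  by have : F z2 <= F (y1 - u); [apply: Fhomo|]; lra.
have U0 : 0 <= U by rewrite addr_ge0.
have e40 : 0 < (1 / 4 : R) by lra.
have [r r0] := small_slab_sphere e40.
(* For [b] of this norm, a normalized product above [r] means that [dotv b] exceeds [U] in absolute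
   value; the added 1 keeps the threshold positive when [U = 0]. *)
have M0 : 0 < (U + 1) / r by rewrite divr_gt0// ltr_wpDl.
move=> Wr; exists ((U + 1) / r); apply: filterS Wr => -[n w]/= Hr b Mb.
have b0 : 0 < `|b| by rewrite (lt_le_trans M0).
pose a := `|b|^-1 *: b.
have a1 : `|a| = 1.
  by rewrite normrZ ger0_norm ?invr_ge0// mulVf// gt_eqF.
have spread : empirical_conv n w b y2 - empirical_conv n w b y1 <= 3 / 8.
  rewrite -avgB.
  apply: (@le_trans _ _ (avg n (fun i => 1 / 8 + (`|dotv a (Xs i w)| <= r)%R%:R))).
    apply: ler_avg => i; case: (leP `|dotv a (Xs i w)| r) => h /=.
      have /andP[F2 F2'] := F01 (y2 - dotv b (Xs i w)).
      by have /andP[F1 F1'] := F01 (y1 - dotv b (Xs i w)); lra.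
    rewrite addr0; apply: FU.
    have -> : b = `|b| *: a by rewrite scalerA divff ?gt_eqF// scale1r.
    rewrite dotvZ normrM normr_id.
    have : (U + 1) / r * r <= `|b| * `|dotv a (Xs i w)|.
      by rewrite ler_pM// ltW.
    by rewrite divfK ?gt_eqF//; lra.
  have h1 : avg n (fun=> 1 / 8 : R) <= 1 / 8 by apply: avg_le_cst.
  rewrite avgD (le_trans (lerD h1 (ltW (Hr _ a1))))//; lra.
have [g1|g1] := leP (1 / 8) `|H y1 - empirical_conv n w b y1|; first by exists y1.
have [g2|g2] := leP (1 / 8) `|H y2 - empirical_conv n w b y2|; first by exists y2.
by move: g1 g2; rewrite !ltr_norml => /andP[? ?] /andP[? ?]; exfalso; lra.
Qed.

End slabs.

End empirical_convolution.

(** * Consistency: Glivenko-Cantelli in probability, continuity of the criterion, conclusion *)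

Lemma uniform_empirical_cdf d (T : measurableType d) (R : realType)
    (P : probability T R) (Y : {RV P >-> R}) (Ys : nat -> {RV P >-> R}) (e : R) :
  iid_copies P Y Ys -> onto_cdf (cdfR Y) -> 0 < e ->
  \forall nw \near whp P,
    forall y, `|empirical_cdf nw.1 (fun i => Ys i nw.2) y - cdfR Y y| <= e.
Proof.
move=> Ys_iid Honto.
apply: (polya (G := fun nw : nat * T => empirical_cdf nw.1 (fun i => Ys i nw.2))) => //.
- by move=> nw; exact: empirical_cdf_homo.
- by move=> nw y; exact: empirical_cdf01.
move=> y r r0.
have := iid_weak_law_set Ys_iid (measurable_itv `]-oo, y]) r0.
apply: filterS => -[n w]/=; rewrite empirical_cdfE.
rewrite (_ : (fun i => \1_(_) _) = (fun i => (Ys i w <= y)%R%:R))//.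
by apply/funext => i; rewrite indicE mem_setE in_itv.
Qed.

(** Continuity in [b] lets the extreme value theorem provide a minimizer on a closed ball. *)
Lemma continuous_sq_dist (R : realType) (k n : nat) (ys : nat -> R)
    (G : 'rV[R]_k -> R -> R) :
  (forall y, continuous (G ^~ y)) -> continuous (fun b => sq_dist n ys (G b)).
Proof.
move=> cG.
pose f (j : 'I_n) b := (empirical_cdf n ys (ys j) - G b (ys j)) ^+ 2.
have cf j : continuous (f j).
  move=> b; have h : empirical_cdf n ys (ys j) - G b' (ys j) @[b' --> b] -->
      empirical_cdf n ys (ys j) - G b (ys j).
    exact: (cvgB (cvg_cst _) (cG (ys j) b)).
  exact: (cvgM h h).
move=> b; exact: (cvgMl_tmp (@continuous_sumr _ _ _ (index_enum _) _ cf b)).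
Qed.

Theorem theorem5 (disp : measure_display) (T : measurableType disp)
    (R : realType) (P : probability T R) (d : nat) (d_ge1 : (1 <= d)%N)
    (X : {RV P >-> borel_rV R d}) (eps Y : {RV P >-> R}) (beta0 : 'rV[R]_d)
    (Xs : nat -> {RV P >-> borel_rV R d}) (Ys : nat -> {RV P >-> R})
    (X_continuous : continuous_distribution X)
    (eps_indep_X : independent_systems P (sigma_of eps) (sigma_of X))
    (model : same_distribution P Y (fun w => dotv beta0 (X w) + eps w))
    (Xs_iid : iid_copies P X Xs)
    (Ys_iid : iid_copies P Y Ys)
    (Xs_indep_Ys : independent_systems P (sigma_of_seq Xs) (sigma_of_seq Ys))
    (eps_density : has_density eps)
    (B0_card1 : (regression_vectors X eps Y #= `I_1)%card)
    (no_hyperplane : forall a : 'rV[R]_d, a != 0 ->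
       P [set w | dotv a (X w) = 0] = 0%E)
    (betahat : nat -> {RV P >-> borel_rV R d})
    (betahat_min : forall n w,
       let Bn := minimizers n (cdfR eps) (fun i => Xs i w) (fun i => Ys i w) in
       Bn !=set0 -> Bn (betahat n w)) :
  cvg_in_probability P betahat beta0.
Proof.
have cF := has_density_continuous eps_density.
have oF := onto_cdfR cF.
have [Fhomo F01 _] := oF.
pose F := cdfR eps; pose H := cdfR Y; pose G := empirical_conv Xs F.
have beta0_B0 : regression_vectors X eps Y beta0.
  move=> y; rewrite -(convolution_independent _ _ eps_indep_X).
  rewrite [LHS](model _ (measurable_itv _)).
  by congr (P _); apply/seteqP; split => w /=; rewrite in_itv.
have HE y : H y = conv_cdf X F beta0 y.
  by apply: EFin_inj; rewrite EFin_cdfR beta0_B0 convolved_cdfE.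
have oH : onto_cdf H.
  apply: onto_cdfR; rewrite -/H (_ : H = conv_cdf X F beta0); last exact/funext.
  exact: continuous_conv_cdf.
have identifiable b : b != beta0 -> exists y, H y != conv_cdf X F b y.
  move=> bb0; apply: contrapT => /forallNP Hb.
  have b_B0 : regression_vectors X eps Y b.
    move=> y; rewrite -EFin_cdfR convolved_cdfE//; congr (_%:E).
    by have /negP := Hb y; rewrite negbK => /eqP.
  have /card_set_bijP[f [f1 finj _]] := B0_card1.
  move/eqP: bb0; apply; apply: finj; rewrite ?inE//.
  by have := f1 _ b_B0; have := f1 _ beta0_B0; case: (f b) (f beta0) => [|?] [|?].
have cdist : continuous (fun b : 'rV[R]_d => `|b - beta0|).
  move=> b; have h : b' - beta0 @[b' --> b] --> b - beta0.
    exact: (@cvgB _ _ _ _ (nbhs_filter b) id (cst beta0) _ _ cvg_id (cvg_cst _)).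
  exact: cvg_norm h.
move=> e e0.
have [M gap_infty] := empirical_conv_gap_infty Xs_iid oF no_hyperplane oH.
have cK : compact [set b : 'rV[R]_d | e <= `|b - beta0| /\ `|b| <= M].
  apply: bounded_closed_compact.
    by exists M; split; [exact: num_real|move=> N MN b /= [_ /le_trans]; apply; exact: ltW].
  apply: closedI.
    by apply: (closed_comp (D := [set x | e <= x]) (fun b _ => cdist b)); exact: closed_ge.
  have cnorm : continuous (fun b : 'rV[R]_d => `|b|) by exact: norm_continuous.
  by apply: (closed_comp (D := [set x | x <= M]) (fun b _ => cnorm b)); exact: closed_le.
have [|e1 e1_gt0 gap_compact] := empirical_conv_gap_compact Xs_iid cF oF cK (H := H).
  move=> b [eb _]; apply: identifiable; apply: contraTneq eb => ->.
  by rewrite subrr normr0 -ltNge.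
(* [8 * eta] must lie below both gaps: [e1] on the compact set and 1/8 for large [b]. *)
pose eta := Num.min (e1 / 8) (1 / 64).
have eta0 : 0 < eta by rewrite lt_min !divr_gt0.
have eta1 : 8 * eta <= e1.
  by have : eta <= e1 / 8 by [rewrite ge_min lexx]; lra.
have eta2 : eta <= 1 / 64 by rewrite ge_min lexx orbT.
(* Two errors of this size bound the criterion at [beta0] by [eta ^+ 4], which is below the bound
   [18 * eta ^+ 3] valid at distance at least [e]. *)
have eta3 : 0 < eta ^+ 2 / 2 by rewrite divr_gt0// exprn_gt0.
have unifY := uniform_empirical_cdf Ys_iid oH eta3.
have unifX : \forall nw \near whp P, forall y, `|G nw.1 nw.2 beta0 y - H y| <= eta ^+ 2 / 2.
  apply: (polya (G := fun nw => G nw.1 nw.2 beta0)) => //.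
  - by move=> nw; exact: empirical_conv_homo.
  - by move=> nw y; exact: empirical_conv01.
  - by move=> y r r0; rewrite HE; exact: empirical_conv_cvg.
apply: whp_cvg0.
  move=> n; rewrite -[mkset _]setTI; apply: measurable_fun_le => //.
  exact: (measurableT_comp (continuous_borel_measurable cdist) (measurable_funPT (betahat n))).
apply: filterS (filterI (filterI unifX unifY) (filterI gap_compact gap_infty)).
move=> -[n w]/= [[uX uY] [gc gi]] /=.
pose ys i := Ys i w; pose D b := sq_dist n ys (G n w b).
have critE b : criterion n F (fun i => Xs i w) ys b = (D b)%:E by exact: criterionE.
have D0 : D beta0 <= eta ^+ 4.
  rewrite (_ : eta ^+ 4 = (eta ^+ 2) ^+ 2); last by rewrite -exprM.
  apply: sq_dist_le; first exact: sqr_ge0.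
  move=> y; have hY : `|empirical_cdf n ys y - H y| <= eta ^+ 2 / 2 by exact: uY.
  have hX : `|H y - G n w beta0 y| <= eta ^+ 2 / 2 by rewrite distrC; exact: uX.
  by rewrite (le_trans (ler_distD (H y) _ _))// (le_trans (lerD hY hX))// -splitr.
have Dfar b : e <= `|b - beta0| -> D beta0 < D b.
  move=> eb; apply: (@lt_le_trans _ _ (18 * eta ^+ 3)).
    rewrite (le_lt_trans D0)// exprS ltr_pM2r ?exprn_gt0//; lra.
  have [y gapy] : exists y, 8 * eta <= `|H y - G n w b y|.
    have [bM|Mb] := leP `|b| M.
      by have [//|y hy] := gc b _; exists y; rewrite (le_trans eta1).
    by have [y hy] := gi b (ltW Mb); exists y; rewrite (le_trans _ hy)//; lra.
  apply: (sq_dist_ge eta0 oH _ _ _ gapy).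
  - exact: empirical_conv_homo.
  - exact: empirical_conv01.
  - move=> z; rewrite (le_trans (uY z))// expr2.
    by have : eta * eta <= eta * 1 by [rewrite ler_pM2l//; lra]; lra.
have cball : compact [set b : 'rV[R]_d | `|b - beta0| <= e].
  apply: bounded_closed_compact.
    exists (e + `|beta0|); split; first exact: num_real.
    move=> N eN b /= be; rewrite (le_trans _ (ltW eN))//.
    by rewrite -[b in X in X <= _](subrK beta0) (le_trans (ler_normD _ _))// lerD2r.
  by apply: (closed_comp (D := [set x | x <= e]) (fun b _ => cdist b)); exact: closed_le.
(* A minimizer on the ball is global, because [beta0] lies in the ball and beats every point
   outside. So the set of minimizers is nonempty and [betahat_min] applies. *)
have [||c cball_c cmin] := @EVT_min_rV R d D _ _ cball.
- by exists beta0; rewrite /= subrr normr0 ltW.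
- apply: continuous_subspaceT; apply: continuous_sq_dist => y.
  exact: continuous_empirical_conv.
have : minimizers n F (fun i => Xs i w) ys (betahat n w).
  apply: betahat_min; exists c => b; rewrite !critE lee_fin.
  have [be|eb] := leP `|b - beta0| e; first by apply: cmin; rewrite inE.
  rewrite (le_trans _ (ltW (Dfar b (ltW eb))))//.
  by apply: cmin; rewrite inE /= subrr normr0 ltW.
move=> /(_ beta0); rewrite !critE lee_fin => Dbeta.
by move=> /Dfar; rewrite ltNge Dbeta.
Qed.
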